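(* Let $X$ be a finite set with $|X|\ge 2$, and fix a total order on $\tilde X$. Let $K\subseteq\tilde X^*$ be a language satisfying $$\mathcal{D}\text{-}\mathrm{SL}(\mathrm{FIM}_X)\subseteq K\subseteq \mathcal{D}\text{-}\mathrm{Geo}(\mathrm{FIM}_X).$$ Then $K$ is not co-context-free. In particular, $\mathcal{D}\text{-}\mathrm{Geo}(\mathrm{FIM}_X)$ and $\mathcal{D}\text{-}\mathrm{SL}(\mathrm{FIM}_X)$ are not co-context-free.
   Context: $\mathrm{FIM}_X$ is the free inverse monoid on $X$; $\tilde X=X\cup X^{-1}$ with $X^{-1}=\{x^{-1}:x\in X\}$ a disjoint copy of $X$; $\pi:\tilde X^*\to \mathrm{FIM}_X$ is the canonical surjective homomorphism; $\ell(w)$ is the length of the word $w$; $\mathcal{D}$ is Green's relation on $\mathrm{FIM}_X$. Then $$\mathcal{D}\text{-}\mathrm{Geo}(\mathrm{FIM}_X)=\bigl\{w\in\tilde X^*: \ell(w)=\min\{\ell(u): u\in\tilde X^*,\ (u\pi)\,\mathcal{D}\,(w\pi)\}\bigr\}.$$ The total order on $\tilde X$ induces the ShortLex order on $\tilde X^*$ (shorter words first, words of equal length compared lexicographically), and $\mathcal{D}\text{-}\mathrm{SL}(\mathrm{FIM}_X)$ is the set of $w\in\tilde X^*$ that are ShortLex-minimal in $\{u\in\tilde X^*: (u\pi)\,\mathcal{D}\,(w\pi)\}$. A language $K\subseteq\tilde X^*$ is co-context-free if its complement $\tilde X^*\setminus K$ is context-free. *)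

(* Defs.v *)
From HB Require Import structures.
From Stdlib Require Import Relation_Operators.
From mathcomp Require Import all_boot.
From mathcomp Require Import generic_quotient.
From mathcomp Require Import boolp classical_sets.

Set Implicit Arguments.
Unset Strict Implicit.
Unset Printing Implicit Defensive.

Local Open Scope classical_set_scope.
Local Open Scope quotient_scope.

(* [inl x] stands for the generator x and [inr x] for its formal inverse. *)
Definition letter (X : finType) : finType := (X + X)%type.

Definition word (X : finType) : choiceType := seq (letter X).

Definition inv_letter (X : finType) (a : letter X) : letter X :=
  match a with inl x => inr x | inr x => inl x end.

Definition inv_word (X : finType) (w : word X) : word X :=
  rev (map (@inv_letter X) w).

(* The Vagner congruence: the quotient [fim X] is the free inverse monoid, since
   w w^-1 w = w and commuting idempotents present it as an involutive monoid. *)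
Inductive vagner (X : finType) : word X -> word X -> Prop :=
| vagner_refl w : vagner w w
| vagner_sym u v : vagner u v -> vagner v u
| vagner_trans u v w : vagner u v -> vagner v w -> vagner u w
| vagner_cat u u' v v' : vagner u u' -> vagner v v' -> vagner (u ++ v) (u' ++ v')
| vagner_regular w : vagner (w ++ inv_word w ++ w) w
| vagner_idem_comm u v :
    vagner ((u ++ inv_word u) ++ (v ++ inv_word v))
           ((v ++ inv_word v) ++ (u ++ inv_word u)).

Definition vagnerb (X : finType) : rel (word X) := fun u v => `[< vagner u v >].

Lemma vagnerb_refl (X : finType) : reflexive (@vagnerb X).
Proof. by move=> u; apply/asboolP; exact: vagner_refl. Qed.

Lemma vagnerb_sym (X : finType) : symmetric (@vagnerb X).
Proof. by move=> u v; apply/asboolP/asboolP; exact: vagner_sym. Qed.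

Lemma vagnerb_trans (X : finType) : transitive (@vagnerb X).
Proof.
by move=> v u w /asboolP uv /asboolP vw; apply/asboolP; exact: vagner_trans vw.
Qed.

Canonical vagner_equiv (X : finType) :=
  EquivRel (@vagnerb X) (@vagnerb_refl X) (@vagnerb_sym X) (@vagnerb_trans X).

Definition fim (X : finType) := {eq_quot (@vagnerb X)}.
HB.instance Definition _ (X : finType) := Choice.on (fim X).

Definition fim_pi (X : finType) (w : word X) : fim X := \pi_(fim X) w.

Lemma fim_piP (X : finType) (u v : word X) :
  fim_pi u = fim_pi v <-> vagner u v.
Proof.
by split=> [/eqmodP/asboolP|uv] //; apply/eqmodP/asboolP.
Qed.

Lemma fim_reprK (X : finType) (a : fim X) : fim_pi (repr a) = a.
Proof. exact: reprK. Qed.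

Lemma fim_pi_surj (X : finType) (a : fim X) : exists w, fim_pi w = a.
Proof. by exists (repr a); exact: fim_reprK. Qed.

Definition fim_mul (X : finType) (a b : fim X) : fim X :=
  fim_pi (repr a ++ repr b).

Definition fim_one (X : finType) : fim X := fim_pi [::].

Lemma fim_mul_pi (X : finType) (u v : word X) :
  fim_mul (fim_pi u) (fim_pi v) = fim_pi (u ++ v).
Proof. by apply/fim_piP/vagner_cat; apply/fim_piP; exact: fim_reprK. Qed.

Lemma fim_mulA (X : finType) : associative (@fim_mul X).
Proof.
move=> a b c; have [u <-] := fim_pi_surj a; have [v <-] := fim_pi_surj b.
by have [w <-] := fim_pi_surj c; rewrite !fim_mul_pi catA.
Qed.

Lemma fim_1mul (X : finType) : left_id (@fim_one X) (@fim_mul X).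
Proof. by move=> a; have [u <-] := fim_pi_surj a; rewrite fim_mul_pi. Qed.

Lemma fim_mul1 (X : finType) : right_id (@fim_one X) (@fim_mul X).
Proof. by move=> a; have [u <-] := fim_pi_surj a; rewrite fim_mul_pi cats0. Qed.

HB.instance Definition _ (X : finType) :=
  isMonoid.Build (fim X) (@fim_mulA X) (@fim_1mul X) (@fim_mul1 X).

Lemma fim_pi1 (X : finType) : fim_pi [::] = 1%g :> fim X.
Proof. by []. Qed.

Lemma fim_piM (X : finType) (u v : word X) :
  fim_pi (u ++ v) = (fim_pi u * fim_pi v)%g.
Proof. by rewrite -fim_mul_pi. Qed.

Definition greenL (M : monoidType) (a b : M) : Prop :=
  (exists s, a = s * b)%g /\ (exists t, b = t * a)%g.

Definition greenR (M : monoidType) (a b : M) : Prop :=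
  (exists s, a = b * s)%g /\ (exists t, b = a * t)%g.

(* D is the composite of L and R; these commute, so it is also their join. *)
Definition greenD (M : monoidType) (a b : M) : Prop :=
  exists2 c, greenL a c & greenR c b.

Definition is_minimum (T : Type) (r : rel T) (E : set T) (x : T) : Prop :=
  E x /\ forall y, E y -> r x y.

Definition total_order (T : Type) (r : rel T) : Prop :=
  [/\ total r, antisymmetric r & transitive r].

Fixpoint lexle (T : eqType) (le : rel T) (s t : seq T) : bool :=
  match s, t with
  | [::], _ => true
  | _ :: _, [::] => false
  | a :: s', b :: t' => if a == b then lexle le s' t' else le a b
  end.

Definition shortlex (T : eqType) (le : rel T) (s t : seq T) : bool :=
  (size s < size t) || (size s == size t) && lexle le s t.

Definition Dclass_words (X : finType) (w : word X) : set (word X) :=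
  [set u | greenD (fim_pi u) (fim_pi w)].

Definition D_Geo (X : finType) : set (word X) :=
  [set w | is_minimum leq [set size u | u in Dclass_words w] (size w)].
Arguments D_Geo X : clear implicits.

Definition D_SL (X : finType) (le : rel (letter X)) : set (word X) :=
  [set w | is_minimum (shortlex le) (Dclass_words w) w].

Record cfg (T : finType) := CFG {
  nonterminal : finType;
  start : nonterminal;
  rules : seq (nonterminal * seq (nonterminal + T))
}.

Inductive cfg_step (T : finType) (G : cfg T) :
    seq (nonterminal G + T) -> seq (nonterminal G + T) -> Prop :=
| CfgStep p q A g : (A, g) \in rules G ->
    cfg_step (p ++ inl A :: q) (p ++ g ++ q).

Definition cfg_language (T : finType) (G : cfg T) : set (seq T) :=
  [set w | clos_refl_trans _ (@cfg_step T G) [:: inl (start G)] (map inr w)].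

Definition context_free (T : finType) (L : set (seq T)) : Prop :=
  exists G : cfg T, cfg_language G = L.

Definition co_context_free (T : finType) (L : set (seq T)) : Prop :=
  context_free (~` L).

(* Main.v *)
From HB Require Import structures.
From Stdlib Require Import Relation_Operators.
Require Import Defs.
From mathcomp Require Import all_boot.
From mathcomp Require Import order ssralg ssrnum ssrint zify.
From mathcomp Require Import boolp classical_sets.

(** The D-class of a word [w] is determined by its Munn tree, the finite subtree
    of the Cayley graph of the free group spanned by the path labelled [w], taken
    up to translation: [u] is D-related to [w] when [u] labels a walk in that
    tree which covers all of it. A word is therefore D-geodesic when its walk runs
    from one end of a diameter to the other, crossing every edge of the diameter
    once and every other edge twice.

    Take [a] the least letter, [b] a letter of another generator, and write [A]
    and [B] for their inverses. The word [a^i b^j B^j' a^k] spans a tripod. For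
    [i = n], [j = j' = n + 1] and large [k] the middle leg is one edge longer than
    the first, so a walk starting at the tip of the middle leg is shorter
    ([not_D_Geo_tripod]) and the word lies outside [K]. Were the complement of [K]
    context-free, Ogden's lemma with the first block marked would pump this
    word inside the complement of [K]. The pumped factors can be chosen within
    single blocks ([context_free_blocks]), so pumping once lengthens the first
    block and at most one other block.

    Whichever block that is, the walk now does follow a diameter. Lengthening
    only one of [j] and [j'] moves the point where the branch leaves the
    diameter but leaves the branch itself of length [n + 1], and the first leg
    has become long enough. Such a word is even ShortLex-least in its D-class
    ([D_SL_tripod]), hence in [K]: a contradiction. The other walks of the same
    length start at another leaf, and so not with the least letter [a].

    Munn trees enter only through readability. The tripod embeds in the grid
    [Z^2] with [a] and [b] as unit steps, and for any set [V] of grid points,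
    whether a word labels some walk inside [V] depends only on its D-class
    ([readable_greenD]). Applied to the tripod and to the tripod with one leaf
    removed, this says that every word of the class labels a walk in the tripod
    visiting its three leaves, and L1 distances between the leaves, which
    coincide with distances in the tree, bound its length ([tripod_class]). *)

Set Implicit Arguments.
Unset Strict Implicit.
Unset Printing Implicit Defensive.

Import GRing.Theory.

(** * Context-free grammars and Ogden's lemma *)

Section Derivations.
Variables (T : finType) (G : cfg T) (U : Type) (f : U -> T).

(** Derivation forests: [s] is a sentential form and [w] a word whose letters
    carry more information than terminals, [f] forgetting it. This lets Ogden's
    marks and the block structure live on the leaves without changing [G]. *)
Inductive derives : seq (nonterminal G + T) -> seq U -> Prop :=
| derives_nil : derives [::] [::]
| derives_terminal a s w : derives s w -> derives (inr (f a) :: s) (a :: w)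
| derives_rule A g s v w : (A, g) \in rules G ->
    derives g v -> derives s w -> derives (inl A :: s) (v ++ w).

Lemma derives_cat s t v w :
  derives s v -> derives t w -> derives (s ++ t) (v ++ w).
Proof.
move=> sv tw; elim: sv => //= [a s' w' _|A g s' v' w' Ag gv _ _ IH].
  exact: derives_terminal.
by rewrite -catA; apply: derives_rule Ag gv IH.
Qed.

Lemma derives_split s t w : derives (s ++ t) w ->
  exists v1 v2, [/\ w = v1 ++ v2, derives s v1 & derives t v2].
Proof.
elim: s w => [|x s IH] w /= sw; first by exists [::], w; split=> //; constructor.
inversion sw as [|a s' w' sw' E1 E2|A g s' v w' Ag gv sw' E1 E2]; subst.
  have [v1 [v2 [-> sv1 tv2]]] := IH _ sw'.
  by exists (a :: v1), v2; split=> //; constructor.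
have [v1 [v2 [-> sv1 tv2]]] := IH _ sw'.
exists (v ++ v1), v2; rewrite catA; split=> //.
exact: derives_rule Ag gv sv1.
Qed.

Lemma derives_step s t w : cfg_step s t -> derives t w -> derives s w.
Proof.
case=> p q A g Ag /derives_split[v1 [v2 [-> pv1 /derives_split]]].
move=> [v3 [v4 [-> gv3 qv4]]].
exact: derives_cat pv1 (derives_rule Ag gv3 qv4).
Qed.

Let steps := clos_refl_trans _ (@cfg_step T G).

Lemma steps_cat p q s t : steps s t -> steps (p ++ s ++ q) (p ++ t ++ q).
Proof.
elim=> [_ _ [p' q' A g Ag]|s'|s1 s2 s3 _ IH1 _ IH2].
- apply: rt_step; rewrite -!catA !cat_cons (catA p) (catA p p').
  exact: CfgStep.
- exact: rt_refl.
- exact: rt_trans IH1 IH2.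
Qed.

Lemma derivesP w : derives [:: inl (start G)] w <-> cfg_language G (map f w).
Proof.
split.
  rewrite /cfg_language /=.
  elim=> [|a s v _ IH|A g s v u Ag _ IHg _ IHs]; first exact: rt_refl.
    by have := steps_cat [:: inr (f a)] [::] IH; rewrite !cats0.
  apply: rt_trans (_ : steps _ (g ++ s)) _.
    exact/rt_step/(CfgStep [::] s Ag).
  have := steps_cat [::] s IHg; rewrite !map_cat /= => IHg'.
  apply: rt_trans IHg' _.
  by have := steps_cat (map inr (map f v)) [::] IHs; rewrite !cats0.
have derw : derives (map inr (map f w)) w by elim: w => //=; constructor.
move: derw; rewrite /cfg_language /=.
move: (map _ _) => t /[swap]; elim=> [s t' st /(derives_step st)||s1 s2 s3 _ IH1 _ IH2 /IH2/IH1] //.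
Qed.

Definition derives_context A B u v :=
  forall z, derives [:: inl B] z -> derives [:: inl A] (u ++ z ++ v).

Lemma derives_context_comp A B C u v p q :
  derives_context A B u v -> derives_context B C p q ->
  derives_context A C (u ++ p) (q ++ v).
Proof. by move=> AB BC z /BC/AB; rewrite -!catA. Qed.

Variable mark : pred U.

Let d := (\max_(r <- rules G) size r.2).+1.

(** Descend from the root, always into a child with more than [t] marks: there is
    one as long as the node carries more than [d * t] marks, since it has at most
    [d] children, and it is not a leaf, since [t] is positive. The descent stops
    at a node with more than [t] and at most [d * t] marks. *)
Lemma subderivation t s w : 0 < t -> derives s w ->
    size s * t < count mark w ->
  exists B u z v, [/\ w = u ++ z ++ v, derives [:: inl B] z,
    t < count mark z <= d * t &
    forall z', derives [:: inl B] z' -> derives s (u ++ z' ++ v)].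
Proof.
move=> t_gt0; elim=> //= {s w} [a s w _ IH|A g s v w Ag gv IHg sw IHs] big.
  have [|B [u [z [v [-> Bz zt ctx]]]]] := IH.
    by move: big; rewrite mulSn; case: (mark a) => /=; lia.
  by exists B, (a :: u), z, v; split=> // z' /ctx; exact: derives_terminal.
have gd : size g <= d.
  have := @leq_bigmax_seq _ (rules G) xpredT (fun r => size r.2) _ Ag isT.
  by move=> /=; exact: leqW.
case: (ltnP (d * t) (count mark v)) => vt.
  have [|B [u [z [v' [-> Bz zt ctx]]]]] := IHg.
    by apply: leq_ltn_trans vt; rewrite leq_mul2r gd orbT.
  exists B, u, z, (v' ++ w); rewrite -!catA; split=> // z' /ctx gz'.
  by have := derives_rule Ag gz' sw; rewrite -!catA.
case: (ltnP t (count mark v)) => vt'.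
  exists A, [::], v, w; split=> //=; last first.
  - by move=> z' Az'; rewrite -(cat1s (inl A) s); exact: derives_cat.
  - by rewrite vt'.
  - by rewrite -(cats0 v); apply: derives_rule Ag gv derives_nil.
have [|B [u [z [v' [-> Bz zt ctx]]]]] := IHs.
  by move: big; rewrite mulSn count_cat; lia.
exists B, (v ++ u), z, v'; rewrite -!catA; split=> // z' /ctx sz'.
by rewrite -catA; exact: derives_rule Ag gv sz'.
Qed.

(** The colour of a node sees the leaves to its left and to its right; it is an
    additional datum that the two nodes bounding a pumped piece must share. *)
Variables (C : finType) (col : seq U -> seq U -> C).

Definition pumpable W := exists x p y q z,
  [/\ W = x ++ p ++ y ++ q ++ z, 0 < count mark (p ++ q),
      col x z = col (x ++ p) (q ++ z) &
      cfg_language G (map f (x ++ p ++ p ++ y ++ q ++ q ++ z))].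

(** One branch of the derivation tree is followed through subtrees with ever fewer
    marks, so that between any two chosen nodes a marked leaf splits off. [seen]
    collects the coloured nonterminals met on the way; their complement shrinks
    at each step, so a repetition occurs before the marks run out. *)
Lemma pumpable_descent k (seen : {set nonterminal G * C}) A u z v :
    #|~: seen| <= k -> derives [:: inl A] z -> d ^ k < count mark z ->
    derives_context (start G) A u v ->
    (forall B c, (B, c) \in seen -> exists x p q y,
       [/\ (u, v) = (x ++ p, q ++ y), c = col x y, 0 < count mark (p ++ q),
           derives_context (start G) B x y & derives_context B A p q]) ->
  pumpable (u ++ z ++ v).
Proof.
elim: k seen A u z v => [|k IH] seen A u z v few Az big ctx anc.
all: case: (boolP ((A, col u v) \in seen)) => [/anc|notin].
1, 3: move=> [x [p [q [y [[-> ->] cE pq sx xp]]]]]; exists x, p, z, q, y.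
1, 2: rewrite -!catA; split=> //; apply/derivesP.
1, 2: by have := sx _ (xp _ (xp _ Az)); rewrite -!catA.
  move: few; rewrite leqn0 cards_eq0 => /eqP/setP/(_ (A, col u v)).
  by rewrite !inE notin.
have dk : 0 < d ^ k by rewrite expn_gt0.
have [|B [u' [z' [v' [zE Bz' /andP[z'l z'u] ctx']]]]] := subderivation dk Az.
  by apply: leq_ltn_trans big; rewrite mul1n expnS leq_pmull.
have uv' : 0 < count mark (u' ++ v').
  by move: big; rewrite zE expnS !count_cat; lia.
suff: pumpable ((u ++ u') ++ z' ++ (v' ++ v)) by rewrite zE -!catA.
apply: (IH ((A, col u v) |: seen) B) => //.
- have : #|~: ((A, col u v) |: seen)| < #|~: seen|.
    apply: proper_card; apply/properP; split.
      by rewrite finset.setCS finset.subsetUr.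
    by exists (A, col u v); rewrite !inE ?eqxx.
  by move=> /leq_trans/(_ few).
- exact: derives_context_comp ctx ctx'.
move=> B' c; rewrite in_setU1 => /orP[/eqP[-> ->]|/anc].
  by exists u, u', v', v; split.
move=> [x [p [q [y [[uE vE] cE pq sx xp]]]]].
exists x, (p ++ u'), (v' ++ q), y; rewrite uE vE -!catA; split=> //.
  by move: pq; rewrite !count_cat; lia.
have := derives_context_comp xp ctx'; exact.
Qed.

Lemma ogden : exists N, forall W,
  cfg_language G (map f W) -> N < count mark W -> pumpable W.
Proof.
exists (d ^ #|{: nonterminal G * C}|) => W /derivesP GW big.
suff: pumpable ([::] ++ W ++ [::]) by rewrite cats0.
apply: (@pumpable_descent #|{: nonterminal G * C}| finset.set0 (start G)) => //.
- by rewrite finset.setC0 cardsT.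
- by move=> z; rewrite cats0.
- by move=> ? ?; rewrite inE.
Qed.
End Derivations.

(** * Pumping words made of blocks *)

Section Blocks.
Variable r : nat.
Implicit Types (e : 'I_r -> nat) (s : seq 'I_r).

(** Letters are represented by the index of their block, so that block words are
    exactly the sorted ones, and are determined by their letter counts. *)
Definition blocks e := flatten [seq nseq (e k) k | k <- enum 'I_r].
Let leI : rel 'I_r := fun i j => i <= j.

Lemma count_blocks e k : count_mem k (blocks e) = e k.
Proof.
rewrite /blocks count_flatten -map_comp sumnE big_map big_enum /= (bigD1 k) //=.
rewrite count_nseq /= eqxx mul1n big1 ?addn0 // => i ik.
by rewrite count_nseq /= (negbTE ik).
Qed.

Let leI_trans : transitive leI. Proof. by move=> j i k; exact: leq_trans. Qed.

Lemma sorted_blocks e : sorted leI (blocks e).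
Proof.
rewrite sorted_pairwise // /blocks.
have : pairwise ltn (map val (enum 'I_r)).
  by rewrite val_enum_ord -sorted_pairwise ?iota_ltn_sorted //; exact: ltn_trans.
elim: (enum 'I_r) => //= i s IH /andP[/allP is_ /IH sP].
rewrite pairwise_cat sP andbT; apply/andP; split.
  apply/allrelP => j k; rewrite mem_nseq => /andP[_ /eqP->] /flattenP[t].
  move=> /mapP[l ls ->]; rewrite mem_nseq => /andP[_ /eqP->].
  by apply/ltnW/is_/map_f.
elim: (e i) => //= n ->; rewrite andbT; apply/allP => j.
by rewrite mem_nseq => /andP[_ /eqP->]; rewrite /leI.
Qed.

Lemma blocks_sorted s : sorted leI s -> s = blocks (fun k => count_mem k s).
Proof.
move=> ss; apply: (sorted_eq leI_trans) => //; last 2 first.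
- exact: sorted_blocks.
- by apply/allP => k _ /=; rewrite count_blocks.
- by move=> i j /anti_leq/val_inj.
Qed.

(** Doubling a factor keeps a word sorted only when the factor lies in one block. *)
Lemma sorted_double x p y q z :
    sorted leI (x ++ p ++ y ++ q ++ z) -> constant p -> constant q ->
  sorted leI (x ++ p ++ p ++ y ++ q ++ q ++ z).
Proof.
have rel_const s : constant s -> allrel leI s s.
  case: s => // i s /all_pred1P E.
  have {E}-> : i :: s = nseq (size s).+1 i by rewrite /= -E.
  apply/allrelP => j k; rewrite !mem_nseq => /andP[_ /eqP->] /andP[_ /eqP->].
  by rewrite /leI.
rewrite !sorted_pairwise // !pairwise_cat !allrel_catr.
move=> /and3P[/and4P[xp xy xq xz] pP /and3P[/and3P[py pq pz] yP]].
move=> /and3P[/andP[yq yz] qP /and3P[qz zQ zP]] /rel_const pp /rel_const qq.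
by rewrite xp xy xq xz pP pp py pq pz yP yq yz qP qq qz zQ zP.
Qed.

Lemma constant_last x p : sorted leI (x ++ p) ->
  ohead (rev x) = ohead (rev (x ++ p)) -> constant p.
Proof.
case: (lastP x) => [|{}x i]; case: (lastP p) => [|{}p j] //.
  by rewrite cat0s rev_rcons.
rewrite rev_cat !rev_rcons /= => + [ij]; subst j.
rewrite sorted_pairwise // pairwise_cat !pairwise_rcons => /and3P[xp _ /andP[pi _]].
have E : rcons p i = nseq (size p).+1 i.
  suff -> : p = nseq (size p) i by rewrite size_nseq -addn1 nseqD cats1.
  apply/all_pred1P/allP => k kp /=; rewrite -val_eqE eqn_leq.
  have ki : (k <= i)%N := allP pi _ kp.
  by rewrite ki; apply: (allrelP xp); rewrite mem_rcons inE ?eqxx ?kp ?orbT.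
by rewrite E /= all_nseq /= eqxx orbT.
Qed.

Lemma constant_head q z : sorted leI (q ++ z) ->
  ohead z = ohead (q ++ z) -> constant q.
Proof.
case: q z => [|i q] [|j z] //= + [ji]; subst j.
rewrite -[path _ _ _]/(sorted leI (i :: q ++ i :: z)) sorted_pairwise //=.
rewrite all_cat pairwise_cat allrel_consr => /andP[/andP[iq _]] /and3P[/andP[qi _] _ _].
apply/allP => k kq /=; rewrite -val_eqE eqn_leq.
by apply/andP; split; [exact: (allP qi _ kq)|exact: (allP iq _ kq)].
Qed.
End Blocks.

Lemma constant_mem (T : eqType) (s : seq T) i j : constant s -> i \in s -> j \in s -> i = j.
Proof.
case: s => //= k s /allP sk; rewrite !inE.
by move=> /orP[/eqP->|/sk/eqP->] /orP[/eqP->|/sk/eqP->].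
Qed.

(** Ogden's lemma, block [m] being marked. As colour of a node, take the last letter
    to its left and the first letter to its right: in a sorted word, two nested
    nodes of the same colour enclose factors that do not cross a block boundary.
    Two factors are pumped, so at most one block other than [m] can grow. *)
Lemma context_free_blocks (T : finType) (L : set (seq T)) (r : nat)
    (c : 'I_r -> T) (m : 'I_r) : context_free L ->
  exists N, forall e : 'I_r -> nat, N < e m -> L (map c (blocks e)) ->
    exists (d : 'I_r -> nat) (i : 'I_r),
      [/\ 0 < d m, forall k, k != m -> k != i -> d k = 0 &
          L (map c (blocks (fun k => e k + d k)))].
Proof.
move=> [G <-].
pose col (x z : seq 'I_r) := (ohead (rev x), ohead z).
have [N pump] := ogden G c (pred1 m) col.
exists N => e; rewrite -(count_blocks e m) => em /pump /(_ em).
move=> [x [p [y [q [z [W]]]]]] pq [/constant_last cp /constant_head cq] GW.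
have sW : sorted (fun i j : 'I_r => i <= j) (x ++ p ++ y ++ q ++ z).
  by rewrite -W; exact: sorted_blocks.
have {}cp : constant p.
  by move: sW; rewrite catA => /cat_sorted2[/cp].
have {}cq : constant q.
  by move: sW; rewrite 2!catA => /cat_sorted2[_ /cq].
have ecount k : count_mem k (x ++ p ++ y ++ q ++ z) = e k.
  by rewrite -W count_blocks.
exists (fun k => count_mem k (p ++ q)).
have [i others] : exists i, forall k, k != m -> k != i -> k \notin p ++ q.
  have /orP[mp|mq] : (m \in p) || (m \in q) by rewrite -mem_cat -has_pred1 has_count.
    (* If the other factor is empty, [m] stands in for its block. *)
    exists (head m q) => k km ki; rewrite mem_cat; apply/norP; split.
      by apply: contra km => kp; apply/eqP; exact: constant_mem kp mp.
    apply: contra ki => kq; apply/eqP/(constant_mem cq) => //.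
    by case: (q) kq => // j q' _; exact: mem_head.
  exists (head m p) => k km ki; rewrite mem_cat; apply/norP; split.
    apply: contra ki => kp; apply/eqP/(constant_mem cp) => //.
    by case: (p) kp => // j q' _; exact: mem_head.
  by apply: contra km => kq; apply/eqP; exact: constant_mem kq mq.
exists i; split=> //.
  by move=> k km ki; apply/count_memPn/others.
have := blocks_sorted (sorted_double sW cp cq).
suff -> : blocks (fun k => e k + count_mem k (p ++ q)) =
  blocks (fun k => count_mem k (x ++ p ++ p ++ y ++ q ++ q ++ z)) by move=> <-.
rewrite /blocks; congr flatten; apply: eq_map => k.
by rewrite -ecount !count_cat; congr nseq; lia.
Qed.

(** * Inverse automata and Green's relation D *)

Lemma inv_letterK (X : finType) : involutive (@inv_letter X).
Proof. by case. Qed.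

Lemma inv_wordK (X : finType) : involutive (@inv_word X).
Proof.
move=> w; rewrite /inv_word map_rev revK -map_comp.
by apply: map_id_in => c _ /=; exact: inv_letterK.
Qed.

Lemma size_inv_word (X : finType) (w : word X) : size (inv_word w) = size w.
Proof. by rewrite size_rev size_map. Qed.

Lemma inv_word_nseq (X : finType) n (c : letter X) :
  inv_word (nseq n c) = nseq n (inv_letter c).
Proof.
rewrite /inv_word map_nseq; move: (inv_letter c) => {}c.
have /all_pred1P -> : all (pred1 c) (rev (nseq n c)) by rewrite all_rev all_nseq /= eqxx orbT.
by rewrite size_rev size_nseq.
Qed.

Section InverseAutomata.
Variables (X : finType) (S : Type) (delta : letter X -> S -> S -> Prop).
Hypothesis delta_fun : forall c P Q Q', delta c P Q -> delta c P Q' -> Q = Q'.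
Hypothesis delta_inv : forall c P Q, delta c P Q -> delta (inv_letter c) Q P.

Fixpoint reads (w : word X) (P Q : S) : Prop :=
  if w is c :: w' then exists2 R, delta c P R & reads w' R Q else P = Q.

Lemma reads_cat u v P Q :
  reads (u ++ v) P Q <-> exists2 R, reads u P R & reads v R Q.
Proof.
elim: u P => [|c u IH] P /=.
  by split=> [|[R ->]] //; exists P.
split=> [[R cR /IH[R' uR' vQ]]|[R' [R cR uR'] vQ]].
  by exists R' => //; exists R.
by exists R => //; apply/IH; exists R'.
Qed.

Lemma reads_inv w P Q : reads w P Q -> reads (inv_word w) Q P.
Proof.
rewrite /inv_word; elim: w P => [|c w IH] P //= [R cR /IH wR].
rewrite rev_cons -cats1; apply/reads_cat; exists R => //.
by exists P => //; exact: delta_inv.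
Qed.

Lemma reads_fun w P Q Q' : reads w P Q -> reads w P Q' -> Q = Q'.
Proof.
elim: w P => [|c w IH] P /=; first by move=> <-.
by move=> [R cR wR] [R' /(delta_fun cR)<-]; exact: IH.
Qed.

Lemma reads_idem w P Q :
  reads (w ++ inv_word w) P Q <-> P = Q /\ exists R, reads w P R.
Proof.
split=> [/reads_cat[R wR wR']|[<- [R wR]]]; last first.
  by apply/reads_cat; exists R => //; exact: reads_inv.
by split; [exact: reads_fun (reads_inv wR) wR' | exists R].
Qed.

(** Words act by partial injections, which form an inverse monoid, so the action
    factors through the free inverse monoid. *)
Lemma reads_vagner u v : vagner u v -> forall P Q, reads u P Q <-> reads v P Q.
Proof.
elim=> {u v} //.
- by move=> u v _ IH P Q; split=> /IH.
- by move=> u v w _ IHu _ IHv P Q; split=> [/IHu/IHv|/IHv/IHu].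
- move=> u u' v v' _ IHu _ IHv P Q; rewrite !reads_cat.
  by split=> -[R /IHu ? /IHv ?]; exists R.
- move=> w P Q; rewrite catA reads_cat; split=> [[R /reads_idem[<-]]|wQ] //.
  by exists P => //; apply/reads_idem; split=> //; exists Q.
- move=> u v P Q; rewrite !(reads_cat (_ ++ _)).
  by split=> -[R /reads_idem[<- uR] /reads_idem[<- vR]]; exists P; apply/reads_idem.
Qed.

Definition readable w := exists P Q, reads w P Q.

(** Being readable somewhere is inherited by factors, and D-related elements are
    factors of each other. *)
Lemma readable_greenD u w :
  greenD (fim_pi u) (fim_pi w) -> readable u <-> readable w.
Proof.
move=> [c]; have [{}c <-] := fim_pi_surj c.
have lift s t : fim_pi s = fim_pi t -> forall P Q, reads s P Q <-> reads t P Q.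
  by move=> /fim_piP/reads_vagner.
move=> [[s +] [t +]] [[s' +] [t' +]].
have [{}s <-] := fim_pi_surj s; have [{}t <-] := fim_pi_surj t.
have [{}s' <-] := fim_pi_surj s'; have [{}t' <-] := fim_pi_surj t'.
rewrite -!fim_piM => /lift us /lift ct /lift cs /lift wt; split.
  move=> [P [Q /us/reads_cat[R _ /cs/reads_cat[R' wR' _]]]].
  by exists R, R'.
move=> [P [Q /wt/reads_cat[R /ct/reads_cat[R' _ uR'] _]]].
by exists R', R.
Qed.
End InverseAutomata.

(** * A tripod with a long middle leg *)

Section NotGeodesic.
Variable X : finType.
Implicit Types p q s : word X.

(** Both walks cover three segments [p], [s] and [q] with a common end; the left one
    starts at the far end of [s], the right one at the far end of [p]. *)
Lemma greenD_tripod p s q :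
  greenD (fim_pi (inv_word s ++ inv_word p ++ p ++ q))
         (fim_pi (p ++ s ++ inv_word s ++ q)).
Proof.
have comm : vagner ((inv_word p ++ p) ++ (s ++ inv_word s))
                   ((s ++ inv_word s) ++ (inv_word p ++ p)).
  by have := vagner_idem_comm (inv_word p) s; rewrite inv_wordK.
exists (fim_pi (p ++ s ++ inv_word s ++ q)); last first.
  by split; exists (fim_pi [::]); rewrite -fim_piM cats0.
split.
  exists (fim_pi (inv_word s ++ inv_word p)); rewrite -fim_piM.
  apply/fim_piP/vagner_sym.
  have -> : (inv_word s ++ inv_word p) ++ p ++ s ++ inv_word s ++ q =
     inv_word s ++ ((inv_word p ++ p) ++ (s ++ inv_word s)) ++ q by rewrite -!catA.
  apply: vagner_trans
    (_ : vagner _ (inv_word s ++ ((s ++ inv_word s) ++ (inv_word p ++ p)) ++ q)) _.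
    by apply/vagner_cat/vagner_cat; [exact: vagner_refl| |exact: vagner_refl].
  have := vagner_cat (vagner_regular (inv_word s)) (vagner_refl (inv_word p ++ p ++ q)).
  by rewrite inv_wordK -!catA.
exists (fim_pi (p ++ s)); rewrite -fim_piM; apply/fim_piP/vagner_sym.
have -> : (p ++ s) ++ inv_word s ++ inv_word p ++ p ++ q =
  p ++ ((s ++ inv_word s) ++ (inv_word p ++ p)) ++ q by rewrite -!catA.
apply: vagner_trans (_ : vagner _ (p ++ ((inv_word p ++ p) ++ (s ++ inv_word s)) ++ q)) _.
  apply/vagner_cat/vagner_cat; [exact: vagner_refl| |exact: vagner_refl].
  exact: vagner_sym.
have := vagner_cat (vagner_regular p) (vagner_refl (s ++ inv_word s ++ q)).
by rewrite -!catA.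
Qed.

Lemma not_D_Geo_tripod p s q :
  size p < size s -> ~ D_Geo X (p ++ s ++ inv_word s ++ q).
Proof.
move=> ps [_ /(_ (size (inv_word s ++ inv_word p ++ p ++ q)))].
have /[swap]/[apply] : [set size u | u in Dclass_words (p ++ s ++ inv_word s ++ q)]%classic
   (size (inv_word s ++ inv_word p ++ p ++ q)).
  by exists (inv_word s ++ inv_word p ++ p ++ q) => //; exact: greenD_tripod.
rewrite !size_cat !size_inv_word; lia.
Qed.
End NotGeodesic.

(** * Walks in the integer grid *)

Section GridWalks.
Local Open Scope ring_scope.
Variables (X : finType) (a b : letter X).
Hypotheses (ba : b != a) (bA : b != inv_letter a).

Definition axial (c : letter X) := c \in [:: a; inv_letter a; b; inv_letter b].

(** Only meaningful on axial letters: every other letter acts like the inverse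
    of [b]. *)
Definition shift (c : letter X) (P : int * int) : int * int :=
  if c == a then (P.1 + 1, P.2) else if c == inv_letter a then (P.1 - 1, P.2)
  else if c == b then (P.1, P.2 + 1) else (P.1, P.2 - 1).

Lemma inv_letter_neq (c : letter X) : (inv_letter c == c) = false.
Proof. by case: c. Qed.

Lemma shift_a P : shift a P = (P.1 + 1, P.2).
Proof. by rewrite /shift eqxx. Qed.
Lemma shift_A P : shift (inv_letter a) P = (P.1 - 1, P.2).
Proof. by rewrite /shift inv_letter_neq eqxx. Qed.
Lemma shift_b P : shift b P = (P.1, P.2 + 1).
Proof. by rewrite /shift (negbTE ba) (negbTE bA) eqxx. Qed.
Lemma shift_B P : shift (inv_letter b) P = (P.1, P.2 - 1).
Proof.
rewrite /shift (inj_eq (inv_inj (@inv_letterK X))) (negbTE ba) inv_letter_neq.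
by rewrite -(inj_eq (inv_inj (@inv_letterK X))) inv_letterK (negbTE bA).
Qed.

Lemma axialP c : axial c -> [\/ c = a, c = inv_letter a, c = b | c = inv_letter b].
Proof.
rewrite /axial !inE => /or4P[]/eqP->.
- exact: Or41.
- exact: Or42.
- exact: Or43.
- exact: Or44.
Qed.

Lemma axial_inv c : axial c -> axial (inv_letter c).
Proof. by move=> /axialP[]->; rewrite /axial ?inv_letterK !inE eqxx ?orbT. Qed.

Definition shiftE := (shift_a, shift_A, shift_b, shift_B).

Lemma shiftK c P : axial c -> shift (inv_letter c) (shift c P) = P.
Proof.
by case: P => x y /axialP[]->; rewrite ?inv_letterK !shiftE /= ?addrK ?subrK.
Qed.

Lemma shift_inj c c' P : axial c -> axial c' -> shift c P = shift c' P -> c = c'.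
Proof.
by move=> /axialP[]-> /axialP[]-> //; rewrite !shiftE => -[]; lia.
Qed.

(** [V] is a set of vertices: a walk may use every grid edge between two of them. *)
Definition grid_step (V : int * int -> Prop) c P Q :=
  [/\ axial c, V P, V Q & Q = shift c P].

Lemma grid_step_fun V c P Q Q' : grid_step V c P Q -> grid_step V c P Q' -> Q = Q'.
Proof. by move=> [_ _ _ ->] [_ _ _ ->]. Qed.

Lemma grid_step_inv V c P Q : grid_step V c P Q -> grid_step V (inv_letter c) Q P.
Proof. by move=> [cX VP VQ QE]; split=> //; [exact: axial_inv|rewrite QE shiftK]. Qed.

Definition trace (P : int * int) (u : word X) := foldl (fun P c => shift c P) P u.

Lemma trace_cat P u v : trace P (u ++ v) = trace (trace P u) v.
Proof. exact: foldl_cat. Qed.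

Definition dist (P Q : int * int) : nat := (`|P.1 - Q.1| + `|P.2 - Q.2|)%N.

Lemma dist_le P Q n : (dist P Q <= n)%N ->
  [/\ P.1 - Q.1 + (P.2 - Q.2) <= n%:Z, P.1 - Q.1 - (P.2 - Q.2) <= n%:Z,
      Q.1 - P.1 + (P.2 - Q.2) <= n%:Z & Q.1 - P.1 - (P.2 - Q.2) <= n%:Z].
Proof. by rewrite /dist => dn; split; lia. Qed.

Lemma dist_trace P u : (dist P (trace P u) <= size u)%N.
Proof.
elim: u P => [|c u IH] P; first by rewrite /dist /=; lia.
have {IH} := IH (shift c P); rewrite /dist /= /shift; case: P => x y /=.
by case: ifP => _ /=; [|case: ifP => _ /=; [|case: ifP => _ /=]]; lia.
Qed.

Lemma dist_trace_take P u s t :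
  (dist (trace P (take s u)) (trace P (take t u)) <= (s - t) + (t - s))%N.
Proof.
wlog st : s t / (s <= t)%N => [hw|].
  case: (leqP s t) => [/hw//|/ltnW/hw]; rewrite /dist; lia.
have -> : take t u = take s u ++ take (t - s) (drop s u) by rewrite -takeD subnKC.
rewrite trace_cat.
apply: leq_trans (dist_trace _ _) _; rewrite size_take_min; lia.
Qed.

Lemma trace_inj P u w : all axial u -> all axial w -> size u = size w ->
  (forall t, (t <= size u)%N -> trace P (take t u) = trace P (take t w)) -> u = w.
Proof.
elim: u w P => [|c u IH] [|c' w] P //= /andP[cX uX] /andP[cX' wX] [uw] eqt.
have := eqt 1%N isT; rewrite /= !take0 /= => /(shift_inj cX cX') cE; subst c'.
congr cons; apply: (IH _ (shift c P)) => // t tu.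
exact: eqt t.+1 tu.
Qed.

(** The empty word is read at every point, inside or outside [V], which is why
    membership in [V] asks for a nonempty word. *)
Lemma reads_trace V u P Q : reads (grid_step V) u P Q ->
  [/\ all axial u, Q = trace P u &
      (0 < size u)%N -> forall t, (t <= size u)%N -> V (trace P (take t u))].
Proof.
elim: u P => [|c u IH] P /=; first by move=> ->.
move=> [R [cX VP VR RE] /IH[uX QE Vu]]; split; rewrite ?cX ?uX -?RE //.
move=> _ [|t] tu //=; rewrite -RE.
by case: u t tu Vu {IH uX QE} => [|c' u] [|t] tu Vu //; exact: Vu.
Qed.

Lemma reads_sub (V V' : int * int -> Prop) u P Q : (forall R, V R -> V' R) ->
  reads (grid_step V) u P Q -> reads (grid_step V') u P Q.
Proof.
move=> VV'; elim: u P => [|c u IH] P //= [R [cX VP VR RE] /IH uR].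
by exists R => //; split; auto.
Qed.

Lemma reads_avoid V u P Q B : reads (grid_step V) u P Q ->
    (forall t, (t <= size u)%N -> trace P (take t u) <> B) ->
  reads (grid_step (fun R => V R /\ R <> B)) u P Q.
Proof.
elim: u P => [|c u IH] P //= [R [cX VP VR RE] uR] avoid.
exists R; last by apply: IH => // t tu; rewrite RE; exact: (avoid t.+1).
split=> //; split=> //; first exact: (avoid 0%N).
by rewrite RE; have := avoid 1%N isT; rewrite /= take0.
Qed.

Lemma axial_a : axial a. Proof. by rewrite /axial !inE eqxx. Qed.
Lemma axial_b : axial b. Proof. by rewrite /axial !inE eqxx !orbT. Qed.

Lemma reads_nseq_a V x y n : (forall t : nat, (t <= n)%N -> V (x + t%:Z, y)) ->
  reads (grid_step V) (nseq n a) (x, y) (x + n%:Z, y).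
Proof.
elim: n x => [|n IH] x Vt /=; first by rewrite addr0.
exists (x + 1, y).
  split; rewrite ?axial_a ?shiftE //; last exact: (Vt 1%N).
  by have := Vt 0%N isT; rewrite addr0.
have -> : x + n.+1%:Z = (x + 1) + n%:Z by lia.
apply: IH => t tn; have -> : x + 1 + t%:Z = x + t.+1%:Z by lia.
exact: Vt.
Qed.

Lemma reads_nseq_b V x y n : (forall t : nat, (t <= n)%N -> V (x, y + t%:Z)) ->
  reads (grid_step V) (nseq n b) (x, y) (x, y + n%:Z).
Proof.
elim: n y => [|n IH] y Vt /=; first by rewrite addr0.
exists (x, y + 1).
  split; rewrite ?axial_b ?shiftE //; last exact: (Vt 1%N).
  by have := Vt 0%N isT; rewrite addr0.
have -> : y + n.+1%:Z = (y + 1) + n%:Z by lia.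
apply: IH => t tn; have -> : y + 1 + t%:Z = y + t.+1%:Z by lia.
exact: Vt.
Qed.

Lemma reads_nseq_B V x y n : (forall t : nat, (t <= n)%N -> V (x, y - t%:Z)) ->
  reads (grid_step V) (nseq n (inv_letter b)) (x, y) (x, y - n%:Z).
Proof.
move=> Vt; rewrite -inv_word_nseq; apply: (reads_inv (@grid_step_inv V)).
have {2}-> : y = (y - n%:Z) + n%:Z by lia.
apply: reads_nseq_b => t tn; have -> : y - n%:Z + t%:Z = y - (n - t)%N%:Z by lia.
by apply: Vt; lia.
Qed.

Lemma trace_nseq_a P n : trace P (nseq n a) = (P.1 + n%:Z, P.2).
Proof. by elim: n P => [|n IH] [x y] /=; rewrite ?IH ?shiftE /= ; congr pair; lia. Qed.
Lemma trace_nseq_b P n : trace P (nseq n b) = (P.1, P.2 + n%:Z).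
Proof. by elim: n P => [|n IH] [x y] /=; rewrite ?IH ?shiftE /= ; congr pair; lia. Qed.
Lemma trace_nseq_B P n : trace P (nseq n (inv_letter b)) = (P.1, P.2 - n%:Z).
Proof. by elim: n P => [|n IH] [x y] /=; rewrite ?IH ?shiftE /= ; congr pair; lia. Qed.

Variables (i j j' k : nat).

Definition tripod_word : word X :=
  nseq i a ++ nseq j b ++ nseq j' (inv_letter b) ++ nseq k a.

(** The vertices visited by [tripod_word] from the origin. The second leg has to
    be the vertical segment spanned by the heights [0], [j] and [j - j']. Two
    grid neighbours in this set are always joined by an edge of the walk, as the
    horizontal arms only share the abscissa [i]. *)
Definition tripod (P : int * int) : Prop :=
  [\/ 0 <= P.1 <= i%:Z /\ P.2 = 0,
      P.1 = i%:Z /\ P.2 <= j%:Z /\ (0 <= P.2 \/ j%:Z - j'%:Z <= P.2) |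
      i%:Z <= P.1 <= i%:Z + k%:Z /\ P.2 = j%:Z - j'%:Z].

(* The three leaves of the tripod. *)
Let A : int * int := (0, 0).
Let B : int * int := (i%:Z, j%:Z).
Let C : int * int := (i%:Z + k%:Z, j%:Z - j'%:Z).

Lemma reads_tripod : reads (grid_step tripod) tripod_word A C.
Proof.
apply/reads_cat; exists (0 + i%:Z, 0).
  by apply: reads_nseq_a => t ti; apply: Or31 => /=; lia.
apply/reads_cat; exists (0 + i%:Z, 0 + j%:Z).
  by apply: reads_nseq_b => t ti; apply: Or32 => /=; lia.
apply/reads_cat; exists (0 + i%:Z, 0 + j%:Z - j'%:Z).
  by apply: reads_nseq_B => t ti; apply: Or32 => /=; lia.
have -> : C = (0 + i%:Z + k%:Z, 0 + j%:Z - j'%:Z) by rewrite /C !add0r.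
by apply: reads_nseq_a => t ti; apply: Or33 => /=; lia.
Qed.

Hypotheses (i_gt0 : (0 < i)%N) (j_gt0 : (0 < j)%N) (j'_gt0 : (0 < j')%N).
(* The distance from [A] to [C] is at least that from [B] to [C], and exceeds that
   from [A] to [B]. *)
Hypothesis BC_AC : (j' <= i + ((j - j') + (j' - j)))%N.
Hypothesis AB_AC : (j < k + ((j - j') + (j' - j)))%N.

Let AB_dist : dist A B = (i + j)%N.
Proof. by rewrite /dist /=; lia. Qed.
Let BC_dist : dist B C = (k + j')%N.
Proof. by rewrite /dist /=; lia. Qed.
Let AC_dist : dist A C = (i + k + ((j - j') + (j' - j)))%N.
Proof. by rewrite /dist /=; lia. Qed.

(** The word moves horizontally by the whole width of the tripod, so it has to
    start on the left edge, which the leaf [A] alone occupies. *)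
Lemma reads_tripod_start P Q : reads (grid_step tripod) tripod_word P Q -> P = A.
Proof.
move=> /reads_trace[_ QE V].
have {}V t : (t <= size tripod_word)%N -> tripod (trace P (take t tripod_word)).
  by apply: V; rewrite !size_cat !size_nseq; lia.
have := V _ (leqnn _); have := V 0%N isT; rewrite take0 take_size /=.
rewrite /tripod_word !trace_cat !(trace_nseq_a, trace_nseq_b, trace_nseq_B) /=.
case: P {V QE} => x y /=.
by move=> [] /= ? [] /= ?; congr pair; lia.
Qed.

Lemma trace_tripod_B : trace A (take (i + j) tripod_word) = B.
Proof.
rewrite /tripod_word catA take_size_cat ?size_cat ?size_nseq //.
by rewrite trace_cat trace_nseq_a trace_nseq_b /= !add0r.
Qed.

Lemma trace_tripod_C : trace A tripod_word = C.
Proof. by have [_ -> _] := reads_trace reads_tripod. Qed.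

Lemma size_tripod_word : size tripod_word = (i + j + j' + k)%N.
Proof. by rewrite !size_cat !size_nseq !addnA. Qed.

Definition tripod_at (t : nat) : int * int :=
  if (t <= i)%N then (t%:Z, 0) else if (t <= i + j)%N then (i%:Z, t%:Z - i%:Z)
  else if (t <= i + j + j')%N then (i%:Z, j%:Z - (t%:Z - i%:Z - j%:Z))
  else (t%:Z - j%:Z - j'%:Z, j%:Z - j'%:Z).

(** Being on a shortest path from [A] to [B], or from [B] to [C], pins down a point
    of the tripod by its distances to both ends. *)
Lemma tripod_pinned R (t : nat) : tripod R -> (t <= i + j + j' + k)%N ->
    (dist A R <= t)%N -> (dist R B <= (t - (i + j)) + ((i + j) - t))%N ->
    (dist R C <= i + j + j' + k - t)%N ->
  R = tripod_at t.
Proof.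
rewrite /tripod_at; case: R => x y VR tN /dist_le/= [A1 A2 A3 A4].
move=> /dist_le/= [B1 B2 B3 B4] /dist_le/= [C1 C2 C3 C4].
case: (leqP t i) => ti; last case: (leqP t (i + j)) => tj; last case: (leqP t (i + j + j')) => tj'.
- have t_ij : ((t - (i + j)) + ((i + j) - t) = i + j - t)%N by clear -ti; lia.
  rewrite t_ij in B1 B2 B3 B4; clear C1 C2 C3 C4 t_ij.
  by case: VR => -[] /= ? ?; congr pair; lia.
- have t_ij : ((t - (i + j)) + ((i + j) - t) = i + j - t)%N by clear -tj; lia.
  rewrite t_ij in B1 B2 B3 B4; clear C1 C2 C3 C4 t_ij.
  by case: VR => -[] /= ? ?; congr pair; lia.
- have t_ij : ((t - (i + j)) + ((i + j) - t) = t - (i + j))%N by clear -tj; lia.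
  rewrite t_ij in B1 B2 B3 B4; clear A1 A2 A3 A4 t_ij.
  by case: VR => -[] /= ? ?; congr pair; lia.
- have t_ij : ((t - (i + j)) + ((i + j) - t) = t - (i + j))%N by clear -tj; lia.
  rewrite t_ij in B1 B2 B3 B4; clear A1 A2 A3 A4 t_ij.
  by case: VR => -[] /= ? ?; congr pair; lia.
Qed.

Variable u : word X.
Hypothesis uD : greenD (fim_pi u) (fim_pi tripod_word).

(** A walk avoiding a leaf would make [u], and hence [tripod_word], readable in the
    tripod without that leaf; but [tripod_word] visits all three. *)
Lemma visits_ends : exists P Q, reads (grid_step tripod) u P Q /\
  forall R, R \in [:: A; B; C] -> exists2 t, (t <= size u)%N & trace P (take t u) = R.
Proof.
have readU V := readable_greenD (@grid_step_fun V) (@grid_step_inv V) uD.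
have [|P [Q uPQ]] := (readU tripod).2; first by exists A, C; exact: reads_tripod.
exists P, Q; split=> // R ends; apply: contrapT => avoid.
have [|P' [Q' wPQ]] := (readU (fun S => tripod S /\ S <> R)).1.
  exists P, Q; apply: reads_avoid => // t tu ut.
  by apply: avoid; exists t.
have [_ _ Vw] := reads_trace wPQ.
have wPQ' : reads (grid_step tripod) tripod_word P' Q'.
  by apply: reads_sub wPQ => S [].
have PA := reads_tripod_start wPQ'; subst P'.
have {}Vw t : (t <= size tripod_word)%N -> trace A (take t tripod_word) <> R.
  by move=> tw; apply: (Vw _ t tw).2; rewrite size_tripod_word; lia.
move: ends; rewrite !inE => /or3P[]/eqP RE; subst R.
- by apply: (Vw 0%N) => //; rewrite take0.
- by apply: (Vw (i + j)%N); rewrite ?trace_tripod_B // size_tripod_word; lia.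
- by apply: (Vw (size tripod_word)) => //; rewrite take_size trace_tripod_C.
Qed.

(** Let the leaves be visited at times [tA], [tB], [tC]. Visiting order [A, B, C]
    takes at least the distance from [A] to [B] plus that from [B] to [C], which
    is the length of [tripod_word], and the distance hypotheses make every other
    order at least as long. In case of equality the walk starts at a leaf: from
    [B] or [C] no step [a] is possible, and from [A] the walk follows the
    shortest paths to [B] and [C], which are unique. The default [a] of [head]
    excludes the empty word from the last case. *)
Lemma tripod_class : (size tripod_word < size u)%N \/
  size tripod_word = size u /\ (u = tripod_word \/ head a u != a).
Proof.
have [P [Q [uPQ ends]]] := visits_ends.
have [uX QE Vu] := reads_trace uPQ.
have [|tA tAu EA] := ends A; first by rewrite !inE eqxx.
have [|tB tBu EB] := ends B; first by rewrite !inE eqxx !orbT.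
have [|tC tCu EC] := ends C; first by rewrite !inE eqxx !orbT.
have AB := dist_trace_take P u tA tB; rewrite EA EB in AB.
have BC := dist_trace_take P u tB tC; rewrite EB EC in BC.
have AC := dist_trace_take P u tA tC; rewrite EA EC in AC.
rewrite size_tripod_word.
case: (ltnP (i + j + j' + k) (size u)) => uN; first by left.
right.
have u_gt0 : (0 < size u)%N.
  by move: AB; rewrite AB_dist; lia.
have start R t : t = 0%N -> trace P (take t u) = R -> ~ tripod (shift a R) -> head a u != a.
  move=> ->; rewrite take0 /= => <-.
  have := Vu u_gt0 1%N u_gt0.
  case: (u) u_gt0 => // c u' _; rewrite /= take0 /= => V1 V1'.
  by apply/eqP => ca; rewrite ca in V1.
have [uE cases] : size u = (i + j + j' + k)%N /\
    [\/ [/\ tA = 0, tB = i + j & tC = size u]%N, tB = 0%N | tC = 0%N].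
  rewrite ?AB_dist ?BC_dist ?AC_dist in AB BC AC.
  have uE : size u = (i + j + j' + k)%N by lia.
  split=> //.
  have [->|tB0] := eqVneq tB 0%N; first by apply: Or32.
  have [->|tC0] := eqVneq tC 0%N; first by apply: Or33.
  by apply: Or31; split; lia.
split=> //; case: cases => [[tA0 tBE tCE]|tB0|tC0]; last 2 first.
- right; apply: start tB0 EB _; rewrite shiftE /tripod /=.
  by move=> [] /=; lia.
- right; apply: start tC0 EC _; rewrite shiftE /tripod /=.
  by move=> [] /=; lia.
left; move: EA; rewrite tA0 take0 /= => PA; subst P tB tC tA.
have [wX _ Vw] := reads_trace reads_tripod.
have w_gt0 : (0 < size tripod_word)%N by rewrite size_tripod_word; lia.
apply: (trace_inj (P := A)) => //; first by rewrite size_tripod_word.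
have near v t : trace A (take (i + j) v) = B -> trace A v = C -> size v = (i + j + j' + k)%N ->
    (t <= size v)%N -> tripod (trace A (take t v)) -> trace A (take t v) = tripod_at t.
  move=> vB vC vN tv V; apply: tripod_pinned; rewrite -?vN //.
  - by have := dist_trace_take A v 0 t; rewrite take0 /=; lia.
  - by have := dist_trace_take A v t (i + j); rewrite vB; lia.
  - by have := dist_trace_take A v t (size v); rewrite take_size vC; lia.
move=> t tu; transitivity (tripod_at t); [|symmetry]; apply: near => //.
- by rewrite -EC take_size.
- exact: Vu.
- exact: trace_tripod_B.
- exact: trace_tripod_C.
- exact: size_tripod_word.
- by rewrite size_tripod_word -uE.
- by apply: Vw => //; rewrite size_tripod_word -uE.
Qed.
End GridWalks.

(** * The theorem *)

Local Open Scope classical_set_scope.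

Section Minimal.
Variables (X : finType) (le : rel (letter X)) (a b : letter X).
Hypotheses (le_a : forall c, le a c) (ba : b != a) (bA : b != inv_letter a).

(** A word of the class is longer, or starts with a letter other than the least
    one, or is the tripod word itself. *)
Lemma D_SL_tripod i j j' k : (0 < i)%N -> (0 < j)%N -> (0 < j')%N ->
    (j' <= i + ((j - j') + (j' - j)))%N -> (j < k + ((j - j') + (j' - j)))%N ->
  D_SL le (tripod_word a b i j j' k).
Proof.
move=> i0 j0 j'0 BC_AC AB_AC.
have lexle_refl (s : word X) : lexle le s s by elim: s => //= c s ->; rewrite eqxx.
have greenD_refl (s : word X) : greenD (fim_pi s) (fim_pi s).
  by exists (fim_pi s); split; exists (fim_pi [::]); rewrite -fim_piM ?cats0.
split; first exact: greenD_refl.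
move=> u /(tripod_class ba bA i0 j0 j'0 BC_AC AB_AC) [|[uw u_case]].
  by rewrite /shortlex => ->.
rewrite /shortlex uw eqxx ltnn /=; case: u_case => [->|]; first exact: lexle_refl.
move: uw; case: i i0 {BC_AC} => // i _; case: u => // c u _ /= ca.
by rewrite eq_sym (negbTE ca) le_a.
Qed.
End Minimal.

Lemma exists_least (T : finType) (le : rel T) (x0 : T) :
  total_order le -> exists x, forall y, le x y.
Proof.
move=> [le_total _ le_trans].
have le_refl : reflexive le by move=> x; have := le_total x x; rewrite orbb.
have [x _ xmin] := @extremumP _ _ le x0 xpredT id le_refl le_trans le_total isT.
by exists x => y; exact: xmin.
Qed.

Lemma map_blocks4 (T : Type) (c0 c1 c2 c3 : T) (e : 'I_4 -> nat) :
  map (fun k : 'I_4 => nth c0 [:: c0; c1; c2; c3] k) (blocks e) =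
  nseq (e (inord 0)) c0 ++ nseq (e (inord 1)) c1 ++
  nseq (e (inord 2)) c2 ++ nseq (e (inord 3)) c3.
Proof.
rewrite /blocks; have -> : enum 'I_4 = [:: inord 0; inord 1; inord 2; inord 3].
  by apply: (inj_map val_inj); rewrite val_enum_ord /= !inordK.
by rewrite /= !map_cat !map_nseq /= !inordK // cats0.
Qed.

Lemma not_co_context_free (X : finType) (le : rel (letter X)) (K : set (word X)) :
  2 <= #|X| -> total_order le -> D_SL le `<=` K -> K `<=` D_Geo X ->
  ~ co_context_free K.
Proof.
move=> X2 leP SLK KGeo coCF.
have [x0 _] : exists x0 : X, x0 \in X by apply/card_gt0P; exact: ltnW.
have [a le_a] := exists_least (inl x0) leP.
have [b ba bA] : exists2 b : letter X, b != a & b != inv_letter a.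
  pose g := match a with inl x => x | inr x => x end.
  have [y yg] : exists y, y \notin pred1 g.
    apply/existsP; rewrite -negb_forall; apply: contraL X2 => /forallP all1.
    rewrite -ltnNge ltnS -(card1 g) subset_leq_card //.
    by apply/fintype.subsetP => z _; exact: all1.
  by exists (inl y); rewrite /g in yg; case: (a) yg.
have [N pump] := context_free_blocks (fun k : 'I_4 => nth a [:: a; b; inv_letter b; a] k) ord0 coCF.
(* The middle leg is one edge longer than the first one, and the last leg is longer
   than the middle one; lengthening the first block alone makes the word minimal. *)
pose e (k : 'I_4) := nth 0 [:: N.+1; N.+2; N.+2; N.+3] k.
have [//||d [i [d0 others]]] := pump e.
  rewrite map_blocks4 /e !inordK // => /KGeo.
  rewrite -[nth 0 _ 2]/N.+2 -inv_word_nseq.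
  by apply: not_D_Geo_tripod; rewrite !size_nseq.
have ord0E : ord0 = inord 0 :> 'I_4 by apply/val_inj; rewrite /= inordK.
have {}others (l m : nat) : 0 < l < 4 -> 0 < m < 4 -> l != m ->
    d (inord l) = 0 \/ d (inord m) = 0.
  move=> /andP[l0 l4] /andP[m0 m4] lm.
  have nz n : 0 < n -> n < 4 -> inord n != ord0 :> 'I_4.
    by move=> n0 n4; rewrite -val_eqE /= inordK // -lt0n.
  have [li|li] := eqVneq (inord l) i; last by left; apply: others => //; exact: nz.
  by right; apply: others; rewrite ?nz // -li -val_eqE /= !inordK // eq_sym.
rewrite map_blocks4; apply; apply/SLK/D_SL_tripod => //; rewrite /e !inordK //=.
all: rewrite ord0E in d0; have := others 1 2; have := others 1 3; have := others 2 3.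
all: move=> /(_ isT isT isT) ? /(_ isT isT isT) ? /(_ isT isT isT) ?; lia.
Qed.

Theorem theorem7p2 (X : finType) (hX : 2 <= #|X|)
    (le : rel (letter X)) (hle : total_order le) :
  (forall K : set (word X),
     D_SL le `<=` K -> K `<=` D_Geo X -> ~ co_context_free K) /\
  ~ co_context_free (D_Geo X) /\
  ~ co_context_free (D_SL le).
Proof.
have SL_Geo : D_SL le `<=` D_Geo X.
  move=> w [ww w_min]; split=> [|_ [u uw <-]]; first by exists w.
  by have := w_min u uw; rewrite /shortlex => /orP[/ltnW|/andP[/eqP->]].
split=> [K SLK KGeo|]; first exact: not_co_context_free hX hle SLK KGeo.
by split; [exact: not_co_context_free hX hle SL_Geo _ | exact: not_co_context_free hX hle _ SL_Geo].
Qed.
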